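(* Let $d\ge 3$ be an integer and $V=\{f:[d]\to\mathbb R:\ \sum_{i} f(i)=0\}$. Then \[ \operatorname{Ent}_\pi(f^2)\le \frac{d-1}{d}\,\delta_d\,\mathcal E(f,f)\qquad\text{for all } f\in V, \] where \[ \delta_d:=\max_{x\in V,\ \|x\|_2=1}\bigl(\log d-H(P_x)\bigr)=\begin{cases}\log(d/2),& d\le 6,\\[1mm] \dfrac{d-2}{d}\log(d-1),& d\ge 7.\end{cases} \]
   Context: $[d]=\{1,\dots,d\}$ and $\pi$ is the uniform probability measure on $[d]$. For $g:[d]\to[0,\infty)$, $\operatorname{Ent}_\pi(g)=\frac1d\sum_i g(i)\log g(i)-\left(\frac1d\sum_i g(i)\right)\log\left(\frac1d\sum_i g(i)\right)$, with $0\log0=0$ and $\log$ the natural logarithm. The Dirichlet form of the simple random walk on the complete graph, with generator $Lf(i)=\frac1{d-1}\sum_{j\neq i}f(j)-f(i)$, is \[ \mathcal E(f,f)=-\mathbb E_\pi[(Lf)f]=\frac{1}{d(d-1)}\sum_{1\le i<j\le d}(f(i)-f(j))^2 . \] Functions on $[d]$ are identified with vectors in $\mathbb R^d$; $\|x\|_2=\left(\sum_i x_i^2\right)^{1/2}$ (unnormalized). For $\|x\|_2=1$, $P_x=(|x_i|^2)_{i=1}^d$, and $H(p)=-\sum_i p_i\log p_i$ is the Shannon entropy. *)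

(* Defs.v *)
From HB Require Import structures.
From mathcomp Require Import all_boot all_order all_algebra ring.
From mathcomp Require Import all_classical all_reals all_analysis.

Set Implicit Arguments.
Unset Strict Implicit.
Unset Printing Implicit Defensive.

Import Order.TTheory GRing.Theory Num.Theory.

Local Open Scope classical_set_scope.
Local Open Scope ring_scope.

Definition unif_mean (R : realType) (d : nat) (g : 'I_d -> R) : R :=
  d%:R^-1 * \sum_(i < d) g i.

(* The library sets [ln 0 = 0], and so [0 * ln 0 = 0], here and in [shannon]. *)
Definition entropy (R : realType) (d : nat) (g : 'I_d -> R) : R :=
  unif_mean (fun i => g i * ln (g i)) - unif_mean g * ln (unif_mean g).

Definition srw_gen (R : realType) (d : nat) (f : 'I_d -> R) (i : 'I_d) : R :=
  (d%:R - 1)^-1 * (\sum_(j < d | j != i) f j) - f i.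

Definition dirichlet (R : realType) (d : nat) (f g : 'I_d -> R) : R :=
  - unif_mean (fun i => srw_gen f i * g i).

Definition zero_sum (R : realType) (d : nat) : set ('I_d -> R) :=
  [set f | \sum_(i < d) f i = 0].

Definition norm2 (R : realType) (d : nat) (x : 'I_d -> R) : R :=
  Num.sqrt (\sum_(i < d) x i ^+ 2).

Definition sq_distr (R : realType) (d : nat) (x : 'I_d -> R) : 'I_d -> R :=
  fun i => `|x i| ^+ 2.

Definition shannon (R : realType) (d : nat) (p : 'I_d -> R) : R :=
  - \sum_(i < d) p i * ln (p i).

Definition deficits (R : realType) (d : nat) : set R :=
  [set ln d%:R - shannon (sq_distr x) |
    x in [set x : 'I_d -> R | zero_sum x /\ norm2 x = 1]].
Arguments deficits : clear implicits.

Definition is_max (R : realType) (S : set R) (m : R) : Prop :=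
  S m /\ ubound S m.

(* [sup] is total; it is the maximum of [deficits R d] only once
   [is_max (deficits R d) (delta R d)] is known. *)
Definition delta (R : realType) (d : nat) : R := sup (deficits R d).

Lemma dirichletE (R : realType) (d : nat) (f : 'I_d -> R) : (1 < d)%N ->
  dirichlet f f = (d%:R * (d%:R - 1))^-1 *
    \sum_(i < d) \sum_(j < d | (i < j)%N) (f i - f j) ^+ 2.
Proof.
move=> d1.
have d0 : (d%:R : R) != 0 by rewrite pnatr_eq0 -lt0n (ltn_trans _ d1).
have dm : (d%:R - 1 : R) != 0 by rewrite subr_eq0 -[1]/(1%:R) eqr_nat gtn_eqF.
set S := \sum_(i < d) f i; set Q := \sum_(i < d) f i ^+ 2.
have EL : \sum_(i < d) srw_gen f i * f i = (d%:R - 1)^-1 * (S ^+ 2 - Q) - Q.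
  transitivity (\sum_(i < d) ((d%:R - 1)^-1 * (S * f i - f i ^+ 2) - f i ^+ 2)).
    apply: eq_bigr => i _; rewrite /srw_gen.
    have -> : \sum_(j < d | j != i) f j = S - f i.
      by rewrite /S [in RHS](bigD1 i) //= addrC addrK.
    ring.
  by rewrite sumrB -mulr_sumr sumrB -mulr_sumr expr2.
have ES : \sum_(i < d) \sum_(j < d) (f i - f j) ^+ 2 = 2 * (d%:R * Q - S ^+ 2).
  transitivity (\sum_(i < d) (d%:R * f i ^+ 2 + Q - 2 * S * f i)).
    apply: eq_bigr => i _.
    transitivity (\sum_(j < d) (f i ^+ 2 + f j ^+ 2 - 2 * f i * f j)).
      by apply: eq_bigr => j _; ring.
    rewrite sumrB big_split /= sumr_const card_ord -mulr_sumr -/S -/Q -mulr_natl.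
    ring.
  rewrite sumrB big_split /= sumr_const card_ord -!mulr_sumr -/S -/Q -mulr_natl.
  ring.
set T := \sum_(i < d) _.
have ET : \sum_(i < d) \sum_(j < d) (f i - f j) ^+ 2 = 2 * T.
  transitivity (T + \sum_(i < d) \sum_(j < d | (j < i)%N) (f i - f j) ^+ 2).
    rewrite -big_split /=; apply: eq_bigr => i _.
    rewrite (bigID (fun j : 'I_d => (i < j)%N)) /=; congr (_ + _).
    rewrite (bigID (fun j : 'I_d => j == i)) /=.
    rewrite big1 ?add0r; last by move=> j /andP[_ /eqP->]; rewrite subrr expr0n.
    by apply: eq_bigl => j; rewrite -leqNgt ltn_neqAle andbC.
  have -> : \sum_(i < d) \sum_(j < d | (j < i)%N) (f i - f j) ^+ 2 = T.
    rewrite /T (exchange_big_dep xpredT) //=.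
    by apply: eq_bigr => i _; apply: eq_bigr => j _; ring.
  ring.
have -> : T = d%:R * Q - S ^+ 2.
  apply: (@mulfI _ 2); first by rewrite pnatr_eq0.
  by rewrite -ET ES.
rewrite /dirichlet /unif_mean EL; field.
by rewrite d0 dm.
Qed.

(* Main.v *)
Require Import Defs.
From mathcomp Require Import all_boot all_order all_algebra zify ring lra.
From mathcomp Require Import all_classical all_reals all_analysis.

Set Implicit Arguments.
Unset Strict Implicit.
Unset Printing Implicit Defensive.

Import Order.TTheory GRing.Theory Num.Theory.

Local Open Scope classical_set_scope.
Local Open Scope ring_scope.

(** For a mean-zero f the Dirichlet form is a multiple of the sum of the f(i)^2
([zero_sum_dirichlet]), so by homogeneity the log-Sobolev bound is the upper
bound on the deficits of unit vectors ([entropy_sqr_le]).  What remains is to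
maximize the sum of the x_i^2 ln (x_i^2) over mean-zero unit vectors x; put
d = n + 2.

If all x_i^2 are at most 1/2 the sum is at most - ln 2.  Otherwise, up to sign,
some coordinate a > 0 has a^2 > 1/2.  The sum and the sum of squares of the
other n + 1 coordinates are then those of (- c, - b, ..., - b) for some
0 < b <= c, and Cauchy-Schwarz confines every one of these coordinates to
[- c, c].  On that interval y^2 ln (y^2) lies below a quadratic polynomial that
agrees with it at - b and - c ([sqr_ln_sqr_cert]); summing the polynomial, which
sees only the two prescribed sums, shows that replacing the other coordinates by
(- c, - b, ..., - b) does not decrease the objective
([dominant_coordinate]).

This leaves the curve proportional to (1 + n r, - 1, - r, ..., - r), with
r = b / c in ]0, 1].  The derivative of the objective along it has the sign of
[profile_slope], whose third derivative is negative; since it also vanishes at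
both ends, it changes sign at most once, from negative to positive
([profile_slope_crossing]).  Hence the objective is at most its value at an end
([profile_le_ends]): at r = 0 the vector (1, - 1, 0, ..., 0) / sqrt 2, of
entropy ln 2, and at r = 1 the vector proportional to (n + 1, - 1, ..., - 1).
The first end wins for n <= 4 and the second for n >= 5 ([profile1_le],
[profile1_ge]). *)

(** * A quadratic majorant of s^2 ln s *)

Lemma mvt_ray (R : realType) (f df : R -> R) (a b : R) :
  (forall x : R, a <= x -> is_derive x 1 f (df x)) -> a < b ->
  exists2 c, a < c < b & f b - f a = df c * (b - a).
Proof.
move=> fdf ab.
have [|||c] := @MVT R f df a b => //.
- by move=> x; rewrite in_itv/= => /andP[/ltW ax _]; exact: fdf.
- apply: derivable_within_continuous => x; rewrite in_itv/= => /andP[ax _].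
  by have [] := fdf x ax.
by rewrite in_itv/= => cab E; exists c.
Qed.

Lemma ray_homo (R : realType) (f df : R -> R) (a b : R) :
  (forall x : R, a <= x -> is_derive x 1 f (df x)) -> a <= b ->
  (forall x, a < x < b -> 0 <= df x) -> f a <= f b.
Proof.
move=> fdf; rewrite le_eqVlt => /predU1P[-> //|ab] df0.
have [c cab E] := mvt_ray fdf ab.
by rewrite -subr_ge0 E mulr_ge0 ?df0// subr_ge0 ltW.
Qed.

Lemma is_derive_ln_affine (R : realType) (n x : R) : 0 < 1 + n * x ->
  is_derive x 1 (fun r : R => ln (1 + n * r)) (n / (1 + n * x)).
Proof.
move=> u0.
have L : is_derive (1 + n * x) 1 (@ln R) (1 + n * x)^-1 by exact: is_derive1_ln.
have A : is_derive x 1 (fun r : R => 1 + n * r) n.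
  by apply: is_derive_eq; rewrite /GRing.scale /=; ring.
rewrite mulrC; exact: (@is_derive1_comp _ (@ln R) (fun r : R => 1 + n * r)).
Qed.

Lemma is_derive_inv_real (R : realType) (f : R -> R) (x a : R) : f x != 0 ->
  is_derive x 1 f a -> is_derive x 1 (fun y => (f y)^-1) (- a / f x ^+ 2).
Proof.
move=> fx0 fa; apply: (is_derive_eq (is_deriveV fx0 fa)).
by rewrite /GRing.scale /= mulrC mulrN mulNr.
Qed.

(** The increasing function ln x + 4 / (x + 1) equals 2 at 1 and
ln 3 + 1 at 3. *)
Lemma ln3_ge1 (R : realType) : 1 <= ln 3 :> R.
Proof.
pose f (x : R) := ln x + 4 * (x + 1)^-1.
pose df (x : R) := x^-1 - 4 / (x + 1) ^+ 2.
have fdf (x : R) : 1 <= x -> is_derive x 1 f (df x).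
  move=> x1; have x0 : 0 < x by lra.
  have L := is_derive1_ln x0.
  have xn : x + 1 != 0 by lra.
  have V : is_derive x 1 (fun y : R => (y + 1)^-1) (- 1 / (x + 1) ^+ 2).
    apply: is_derive_inv_real => //.
    by apply: is_derive_eq; rewrite addr0.
  apply: is_derive_eq; rewrite /df /GRing.scale /=.
  by field; rewrite xn; lra.
have : f 1 <= f 3.
  apply: (ray_homo fdf) => [|x /andP[x1 _]]; first by lra.
  rewrite /df.
  have -> : x^-1 - 4 / (x + 1) ^+ 2 = (x - 1) ^+ 2 / (x * (x + 1) ^+ 2).
    by field; apply/andP; split; lra.
  by apply: divr_ge0; [exact: sqr_ge0|apply: mulr_ge0; [lra|exact: sqr_ge0]].
rewrite /f ln1 add0r.
have -> : 4 * (1 + 1)^-1 = 2 :> R by field.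
have -> : 4 * (3 + 1)^-1 = 1 :> R by field.
lra.
Qed.

Lemma ln_le_half_sub_inv (R : realType) (s : R) : 1 <= s ->
  ln s <= (s - s^-1) / 2.
Proof.
move=> s1.
pose f (x : R) := (x - x^-1) / 2 - ln x.
pose df (x : R) := (x - 1) ^+ 2 / (2 * x ^+ 2).
have fdf (x : R) : 1 <= x -> is_derive x 1 f (df x).
  move=> x1; have x0 : 0 < x by lra.
  have L := is_derive1_ln x0.
  have xn : x != 0 by lra.
  have V : is_derive x 1 (fun y : R => y^-1) (- 1 / x ^+ 2).
    exact: is_derive_inv_real.
  apply: is_derive_eq; rewrite /df /GRing.scale /=.
  by field.
have : f 1 <= f s.
  apply: (ray_homo fdf) => // x /andP[x1 _].
  by apply: divr_ge0; rewrite ?sqr_ge0// mulr_ge0 ?sqr_ge0.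
rewrite /f ln1 invr1; lra.
Qed.

(** The quadratic polynomial is the Taylor expansion of 2 s^2 ln s at 1 to
second order, and the third derivative of 2 s^2 ln s is 4 / s > 0, so the
difference changes sign at 1. *)
Lemma sqr_ln_osculating (R : realType) (s : R) : 0 < s ->
  ((1 <= s) -> s ^+ 2 - 1 + 2 * (s - 1) ^+ 2 <= 2 * s ^+ 2 * ln s) /\
  ((s <= 1) -> 2 * s ^+ 2 * ln s <= s ^+ 2 - 1 + 2 * (s - 1) ^+ 2).
Proof.
move=> s0.
pose f (x : R) := 2 * ln x - 3 + 4 * x^-1 - x ^- 2.
pose df (x : R) := 2 * (x - 1) ^+ 2 / x ^+ 3.
have fdf (x : R) : 0 < x -> is_derive x 1 f (df x).
  move=> x0.
  have L := is_derive1_ln x0.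
  have xn : x != 0 by lra.
  have V : is_derive x 1 (fun y : R => y^-1) (- 1 / x ^+ 2).
    exact: is_derive_inv_real.
  have V2 : is_derive x 1 (fun y : R => y ^- 2) (- (2 * x) / (x ^+ 2) ^+ 2).
    apply: is_derive_inv_real; first by rewrite sqrf_eq0.
    by apply: is_derive_eq; rewrite /GRing.scale /=; ring.
  apply: is_derive_eq; rewrite /df /GRing.scale /=.
  by field.
have df0 x : 0 < x -> 0 <= df x.
  move=> x0; apply: divr_ge0; last by rewrite exprn_ge0 ?ltW.
  by rewrite mulr_ge0 ?sqr_ge0.
have f1 : f 1 = 0 by rewrite /f ln1 expr1n invr1; ring.
have E : 2 * s ^+ 2 * ln s - (s ^+ 2 - 1 + 2 * (s - 1) ^+ 2) = s ^+ 2 * f s.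
  by rewrite /f; field; lra.
split=> h.
  rewrite -subr_ge0 E mulr_ge0 ?sqr_ge0// -f1.
  apply: (@ray_homo _ f df) => // x; first by move=> ?; apply: fdf; lra.
  by move=> /andP[? _]; apply: df0; lra.
rewrite -subr_le0 E mulr_ge0_le0 ?sqr_ge0// -f1.
apply: (@ray_homo _ f df) => // x; first by move=> ?; apply: fdf; lra.
by move=> /andP[? _]; apply: df0; lra.
Qed.

(** The k for which the polynomial s^2 - 1 + k (s - 1)^2, tangent to
2 s^2 ln s at 1 for every k, also meets it at s. *)
Definition tangent_curvature (R : realType) (s : R) : R :=
  (2 * s ^+ 2 * ln s - s ^+ 2 + 1) / (s - 1) ^+ 2.

Lemma tangent_curvature_homo (R : realType) (s t : R) : 1 < s -> s <= t ->
  tangent_curvature s <= tangent_curvature t.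
Proof.
move=> s1 st.
pose df (x : R) := 4 * x * ((x - x^-1) / 2 - ln x) / (x - 1) ^+ 3.
apply: (@ray_homo _ _ df) => //.
  move=> x sx; have x0 : 0 < x by lra.
  have L := is_derive1_ln x0.
  have xn : x - 1 != 0 by lra.
  have V2 : is_derive x 1 (fun y : R => (y - 1) ^- 2)
      (- (2 * (x - 1)) / ((x - 1) ^+ 2) ^+ 2).
    apply: is_derive_inv_real; first by rewrite sqrf_eq0.
    by apply: is_derive_eq; rewrite /GRing.scale /=; ring.
  rewrite /tangent_curvature.
  apply: is_derive_eq; rewrite /df /GRing.scale /=.
  by field; rewrite xn; lra.
move=> x /andP[sx _].
apply: divr_ge0; last by apply: exprn_ge0; lra.
apply: mulr_ge0; first by lra.
by rewrite subr_ge0 ln_le_half_sub_inv//; lra.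
Qed.

(** Among the quadratic polynomials tangent to 2 s^2 ln s at 1, the one that
meets it again at t lies above it on [0, t]: to the left of 1 because its k is
at least the osculating value 2, between 1 and t because [tangent_curvature]
increases.  At t = 1 the second contact is the osculating polynomial itself. *)
Lemma sqr_ln_cert (R : realType) (t : R) : 1 <= t -> exists k : R,
  [/\ 2 <= k, 2 * t ^+ 2 * ln t = t ^+ 2 - 1 + k * (t - 1) ^+ 2 &
   forall s, 0 <= s <= t ->
     2 * s ^+ 2 * ln s <= s ^+ 2 - 1 + k * (s - 1) ^+ 2].
Proof.
rewrite le_eqVlt => /predU1P[<-|t1].
  exists 2; split; [by []|by rewrite ln1; ring|move=> s /andP[s0 s1]].
  move: s0; rewrite le_eqVlt => /predU1P[<-|s0]; first by rewrite !expr2; lra.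
  exact: (sqr_ln_osculating s0).2.
have tn : t - 1 != 0 by lra.
have t0 : 0 < t by lra.
have tE : 2 * t ^+ 2 * ln t = t ^+ 2 - 1 + tangent_curvature t * (t - 1) ^+ 2.
  by rewrite /tangent_curvature; field.
have k2 : 2 <= tangent_curvature t.
  rewrite /tangent_curvature ler_pdivlMr; last by rewrite exprn_gt0//; lra.
  by have := (sqr_ln_osculating t0).1 (ltW t1); lra.
exists (tangent_curvature t); split => // s /andP[s0 st].
have [s1|s1] := leP s 1.
  move: s0; rewrite le_eqVlt => /predU1P[<-|s0]; first by rewrite !expr2; lra.
  apply: (le_trans ((sqr_ln_osculating s0).2 s1)).
  by rewrite lerD2l ler_wpM2r// sqr_ge0.
have := tangent_curvature_homo s1 st.
rewrite {1}/tangent_curvature ler_pdivrMr; last by rewrite exprn_gt0//; lra.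
lra.
Qed.

(** * The objective along a one-parameter family *)

(** The derivative of [profile], up to a positive factor; see
[profile_is_derive]. *)
Definition profile_slope (R : realType) (n r : R) : R :=
  (2 + n * r) * (r * ln r) + (1 - r) * ((1 + n * r) * ln (1 + n * r)).

(** Squared norm of (1 + n r, - 1, - r, ..., - r), with n entries - r. *)
Definition profile_mass (R : realType) (n r : R) : R :=
  (1 + n * r) ^+ 2 + 1 + n * r ^+ 2.

(** The sum of the p_i ln p_i for the squares p_i of the coordinates of the
normalization of (1 + n r, - 1, - r, ..., - r). *)
Definition profile (R : realType) (n r : R) : R :=
  (2 * (1 + n * r) ^+ 2 * ln (1 + n * r) + 2 * n * r ^+ 2 * ln r)
    / profile_mass n r - ln (profile_mass n r).

(** The third derivative is negative, so the second derivative decreases.  A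
positive value followed by a negative one, together with the zeros at both ends
of ]0, 1[, would make the slope rise, fall and rise again; its second derivative
would then be negative before being positive. *)
Lemma profile_slope_crossing (R : realType) (n s r : R) : 0 < n ->
  0 < s -> s < r -> r < 1 ->
  0 < profile_slope n s -> 0 <= profile_slope n r.
Proof.
move=> n0 s0 sr r1 ws; rewrite leNgt; apply/negP => wr.
pose w1 (x : R) := (2 + 2 * n * x) * ln x + 2 + n * x
  + (n - 1 - 2 * n * x) * ln (1 + n * x) + n * (1 - x).
pose w2 (x : R) := 2 * n * ln x + (2 + 2 * n * x) / x - 2 * n * ln (1 + n * x)
  + n * (n - 1 - 2 * n * x) / (1 + n * x).
pose w3 (x : R) := - (2 + 2 * n * x + n ^+ 2 * (n + 1) * x ^+ 2)
  / (x ^+ 2 * (1 + n * x) ^+ 2).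
have u0 (x : R) : 0 < x -> 0 < 1 + n * x by move=> x0; rewrite addr_gt0// mulr_gt0.
have dw (x : R) : 0 < x -> is_derive x 1 (profile_slope n) (w1 x).
  move=> x0; have := u0 _ x0 => ux.
  have L1 := is_derive1_ln x0; have L2 := is_derive_ln_affine ux.
  rewrite /profile_slope; apply: is_derive_eq; rewrite /w1 /GRing.scale /=.
  by field; lra.
have dw1 (x : R) : 0 < x -> is_derive x 1 w1 (w2 x).
  move=> x0; have := u0 _ x0 => ux.
  have L1 := is_derive1_ln x0; have L2 := is_derive_ln_affine ux.
  rewrite /w1; apply: is_derive_eq; rewrite /w2 /GRing.scale /=.
  by field; lra.
have dw2 (x : R) : 0 < x -> is_derive x 1 w2 (w3 x).
  move=> x0; have := u0 _ x0 => ux.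
  have L1 := is_derive1_ln x0; have L2 := is_derive_ln_affine ux.
  have xn : x != 0 by lra.
  have un : 1 + n * x != 0 by lra.
  have V1 : is_derive x 1 (fun y : R => y^-1) (- 1 / x ^+ 2).
    exact: is_derive_inv_real.
  have V2 : is_derive x 1 (fun y : R => (1 + n * y)^-1) (- n / (1 + n * x) ^+ 2).
    apply: is_derive_inv_real => //.
    by apply: is_derive_eq; rewrite /GRing.scale /=; ring.
  rewrite /w2; apply: is_derive_eq; rewrite /w3 /GRing.scale /=.
  by field; lra.
have w3N (x : R) : 0 < x -> w3 x < 0.
  move=> x0; have := u0 _ x0 => ux.
  rewrite /w3 mulNr oppr_lt0 divr_gt0//; last by rewrite mulr_gt0 ?exprn_gt0.
  have nx : 0 < n * x by rewrite mulr_gt0.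
  have : 0 <= n ^+ 2 * (n + 1) * x ^+ 2.
    by rewrite !mulr_ge0 ?sqr_ge0//; lra.
  lra.
have w1E : profile_slope n 1 = 0.
  by rewrite /profile_slope ln1; ring.
(* The logarithm is singular at 0, so a point e close to 0 stands for the left
     end; there the slope is at most n (n + 1) e. *)
pose e := Num.min (s / 2) (profile_slope n s / (2 * n * (n + 1))).
have nn : 0 < n * (n + 1) by apply: mulr_gt0; lra.
have e0 : 0 < e.
  rewrite /e lt_min; apply/andP; split; first by lra.
  by apply: divr_gt0; lra.
have es : e < s by rewrite /e gt_min; apply/orP; left; lra.
have we : profile_slope n e < profile_slope n s.
  have e1 : e < 1 by lra.
  have ln_e : ln e <= 0 by apply: ln_le0; lra.
  have ue := u0 _ e0.
  have ln_u : ln (1 + n * e) <= n * e.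
    by apply: le_ln1Dx; rewrite (lt_trans (ltrN10 _))// mulr_gt0.
  have ne : 0 < n * e by rewrite mulr_gt0.
  have ln_u0 : 0 <= ln (1 + n * e) by apply: ln_ge0; lra.
  have A : (2 + n * e) * (e * ln e) <= 0.
    by apply: mulr_ge0_le0; [lra|apply: mulr_ge0_le0; lra].
  have B : (1 - e) * ((1 + n * e) * ln (1 + n * e)) <= (1 + n) * (n * e).
    have h1 : (1 - e) * ((1 + n * e) * ln (1 + n * e))
              <= (1 + n * e) * ln (1 + n * e).
      apply: ler_piMl; last by lra.
      by apply: mulr_ge0; lra.
    apply: (le_trans h1); apply: ler_pM => //; first by lra.
    have : n * e <= n * 1 by rewrite ler_pM2l; lra.
    lra.
  have C : (1 + n) * (n * e) <= profile_slope n s / 2.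
    have : e <= profile_slope n s / (2 * n * (n + 1)) by rewrite /e ge_min lexx orbT.
    rewrite ler_pdivlMr; last by lra.
    lra.
  rewrite {1}/profile_slope; lra.
have [x1 /andP[ex1 x1s] E1] : exists2 c, e < c < s &
    profile_slope n s - profile_slope n e = w1 c * (s - e).
  by apply: mvt_ray => [x ex|]; [apply: dw|]; lra.
have [x2 /andP[sx2 x2r] E2] : exists2 c, s < c < r &
    profile_slope n r - profile_slope n s = w1 c * (r - s).
  by apply: mvt_ray => [x ex|]; [apply: dw|]; lra.
have [x3 /andP[rx3 x31] E3] : exists2 c, r < c < 1 &
    profile_slope n 1 - profile_slope n r = w1 c * (1 - r).
  by apply: mvt_ray => [x ex|]; [apply: dw|]; lra.
have {E1} E1 : 0 < w1 x1.
  by rewrite -(@pmulr_lgt0 _ (s - e)) -?E1; lra.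
have {E2} E2 : w1 x2 < 0.
  by rewrite -(@pmulr_llt0 _ (r - s)) -?E2; lra.
have {E3} E3 : 0 < w1 x3.
  by rewrite -(@pmulr_lgt0 _ (1 - r)) -?E3; lra.
have [y1 /andP[x1y1 y1x2] F1] : exists2 c, x1 < c < x2 &
    w1 x2 - w1 x1 = w2 c * (x2 - x1).
  by apply: mvt_ray => [x ex|]; [apply: dw1|]; lra.
have [y2 /andP[x2y2 y2x3] F2] : exists2 c, x2 < c < x3 &
    w1 x3 - w1 x2 = w2 c * (x3 - x2).
  by apply: mvt_ray => [x ex|]; [apply: dw1|]; lra.
have {F1} F1 : w2 y1 < 0.
  by rewrite -(@pmulr_llt0 _ (x2 - x1)) -?F1; lra.
have {F2} F2 : 0 < w2 y2.
  by rewrite -(@pmulr_lgt0 _ (x3 - x2)) -?F2; lra.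
have [z /andP[y1z zy2] H] : exists2 c, y1 < c < y2 &
    w2 y2 - w2 y1 = w3 c * (y2 - y1).
  by apply: mvt_ray => [x ex|]; [apply: dw2|]; lra.
have : w3 z * (y2 - y1) < 0 by rewrite pmulr_llt0 ?w3N//; lra.
by rewrite -H; lra.
Qed.

Lemma profile_mass_ge (R : realType) (n r : R) : 0 < n -> 0 < r ->
  [/\ 1 < 1 + n * r, 2 <= profile_mass n r &
      (1 + n * r) ^+ 2 <= profile_mass n r].
Proof.
move=> n0 r0; have nr : 0 < n * r by rewrite mulr_gt0.
have nr2 : 0 <= n * r ^+ 2 by rewrite mulr_ge0 ?sqr_ge0//; lra.
have : 1 <= (1 + n * r) ^+ 2 by rewrite exprn_ege1//; lra.
by rewrite /profile_mass; split; lra.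
Qed.

(** The quotient rule produces 1 + n r^2 - r (1 + n r) = 1 - r and
(1 + n r)^2 + 1 - n r (1 + n r) = 2 + n r as the coefficients of the two
logarithmic terms of [profile_slope]. *)
Lemma profile_is_derive (R : realType) (n r : R) : 0 < n -> 0 < r ->
  is_derive r 1 (profile n) (4 * n * profile_slope n r / profile_mass n r ^+ 2).
Proof.
move=> n0 r0; have [u1 S2 _] := profile_mass_ge n0 r0.
have u0 : 0 < 1 + n * r by lra.
have L1 := is_derive1_ln r0; have L2 := is_derive_ln_affine u0.
have S0 : 0 < profile_mass n r by lra.
have dS : is_derive r 1 (profile_mass n) (2 * n * (1 + n * r + r)).
  rewrite /profile_mass; apply: is_derive_eq; rewrite /GRing.scale /=; ring.
have Sn : profile_mass n r != 0 by lra.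
have V := is_derive_inv_real Sn dS.
have L3 : is_derive r 1 (fun y => ln (profile_mass n y))
    ((profile_mass n r)^-1 * (2 * n * (1 + n * r + r))).
  by apply: (@is_derive1_comp _ (@ln R) (profile_mass n)); exact: is_derive1_ln.
rewrite {1}/profile; apply: is_derive_eq; rewrite /GRing.scale /=.
rewrite /profile_slope /profile_mass.
field; rewrite -/(profile_mass n r) Sn; lra.
Qed.

(** If the slope is positive somewhere in ]0, r] it stays nonnegative on [r, 1],
and the profile increases up to 1.  Otherwise the profile decreases on ]0, r],
so its value at r is at most its values near 0, which tend to - ln 2. *)
Lemma profile_le_ends (R : realType) (n r : R) : 0 < n -> 0 < r -> r <= 1 ->
  profile n r <= - ln 2 \/ profile n r <= profile n 1.
Proof.
move=> n0 r0 r1.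
have [[s [/andP[s0 sr] ws]]|noS] :=
    pselect (exists s, 0 < s <= r /\ 0 < profile_slope n s).
  right.
  have dp (x : R) : r <= x -> is_derive x 1 (profile n)
      (4 * n * profile_slope n x / profile_mass n x ^+ 2).
    by move=> rx; apply: profile_is_derive => //; lra.
  apply: (ray_homo dp r1) => x /andP[rx x1]; apply: divr_ge0; last exact: sqr_ge0.
  apply: mulr_ge0; first by lra.
  by apply: (profile_slope_crossing n0 s0) => //; lra.
left; apply/ler_addgt0Pr => e e0.
(* With this t, the logarithmic quotient of the profile is at most 2 n t <= e. *)
pose t := Num.min r (e / (2 * n)).
have t0 : 0 < t by rewrite /t lt_min r0 divr_gt0//; lra.
have tr : t <= r by rewrite /t ge_min lexx.
have te : 2 * (n * t) <= e.
  have : t <= e / (2 * n) by rewrite /t ge_min lexx orbT.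
  by rewrite ler_pdivlMr; lra.
have le_t : profile n r <= profile n t.
  have dp (x : R) : t <= x -> is_derive x 1 (fun x => - profile n x)
      (- (4 * n * profile_slope n x / profile_mass n x ^+ 2)).
    by move=> tx; apply/is_deriveN/profile_is_derive/(lt_le_trans t0 tx).
  rewrite -lerN2; apply: (ray_homo dp tr) => x /andP[tx xr]; rewrite oppr_ge0 pmulr_lle0.
    rewrite pmulr_rle0; last by lra.
    by rewrite leNgt; apply/negP => wx; apply: noS; exists x; split => //; lra.
  have [_ ? _] := @profile_mass_ge _ n x n0 (lt_trans t0 tx).
  by rewrite invr_gt0 exprn_gt0//; lra.
apply: (le_trans le_t).
have [u1 S2 uS] := profile_mass_ge n0 t0.
have lnS : ln 2 <= ln (profile_mass n t).
  by rewrite ler_ln ?posrE//; lra.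
have ln_t : ln t <= 0 by apply: ln_le0; lra.
have ln_u : ln (1 + n * t) <= n * t by apply: le_ln1Dx; lra.
have ln_u0 : 0 <= ln (1 + n * t) by apply: ln_ge0; lra.
have : (2 * (1 + n * t) ^+ 2 * ln (1 + n * t) + 2 * n * t ^+ 2 * ln t)
    / profile_mass n t <= e.
  rewrite ler_pdivrMr; last by lra.
  have : 2 * n * t ^+ 2 * ln t <= 0.
    apply: mulr_ge0_le0 => //; apply: mulr_ge0; rewrite ?sqr_ge0//; lra.
  have : (1 + n * t) ^+ 2 * (2 * ln (1 + n * t)) <= profile_mass n t * e.
    by apply: ler_pM; rewrite ?sqr_ge0//; lra.
  lra.
rewrite /profile; lra.
Qed.

(** * Reduction to one parameter *)

Definition sqr_ln_sqr (R : realType) (z : R) : R := z ^+ 2 * ln (z ^+ 2).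

Lemma sqr_ln_sqrN (R : realType) (z : R) : sqr_ln_sqr (- z) = sqr_ln_sqr z.
Proof. by rewrite /sqr_ln_sqr sqrrN. Qed.

Lemma sqr_ln_sqrE (R : realType) (z : R) : 0 < z ->
  sqr_ln_sqr z = 2 * z ^+ 2 * ln z.
Proof. by move=> z0; rewrite /sqr_ln_sqr lnXn// -mulr_natr; ring. Qed.

(** For negative y this is [sqr_ln_cert] rescaled by b.  Since q >= 0, passing
from - |y| to |y| only increases the right-hand side, whereas y^2 ln (y^2) is
even. *)
Lemma sqr_ln_sqr_cert (R : realType) (b c : R) : 0 < b -> b <= c ->
  exists p q m : R,
  [/\ sqr_ln_sqr b = p - q * b + m * b ^+ 2,
      sqr_ln_sqr c = p - q * c + m * c ^+ 2 &
      forall y, - c <= y <= c -> sqr_ln_sqr y <= p + q * y + m * y ^+ 2].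
Proof.
move=> b0 bc.
have t1 : 1 <= c / b by rewrite ler_pdivlMr// mul1r.
have [k [k2 kt ks]] := sqr_ln_cert t1.
have scale s : 0 < s -> sqr_ln_sqr (b * s) =
    b ^+ 2 * (2 * s ^+ 2 * ln s) + (b * s) ^+ 2 * (2 * ln b).
  move=> s0; rewrite sqr_ln_sqrE ?mulr_gt0// lnM ?posrE//; ring.
have bn : b != 0 by lra.
exists ((k - 1) * b ^+ 2), (2 * k * b), (k + 1 + 2 * ln b); split.
- by rewrite sqr_ln_sqrE//; ring.
- have -> : c = b * (c / b) by field.
  rewrite scale; last by lra.
  by rewrite kt; field.
move=> y /andP[cy yc].
have [->|y0] := eqVneq y 0.
  rewrite /sqr_ln_sqr expr0n /= mul0r !mulr0 !addr0.
  by rewrite mulr_ge0 ?sqr_ge0//; lra.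
have ny : 0 < `|y| / b by rewrite divr_gt0 ?normr_gt0.
have yE : `|y| = b * (`|y| / b) by field.
have -> : sqr_ln_sqr y = sqr_ln_sqr `|y|.
  by rewrite /sqr_ln_sqr real_normK ?num_real.
have := ks (`|y| / b).
have -> : 0 <= `|y| / b <= c / b.
  by rewrite (ltW ny) /= ler_pM2r ?invr_gt0// ler_norml cy.
move=> /(_ isT) h.
rewrite {1}yE scale// -yE.
have hb : b ^+ 2 * (2 * (`|y| / b) ^+ 2 * ln (`|y| / b)) <=
  b ^+ 2 * ((`|y| / b) ^+ 2 - 1 + k * (`|y| / b - 1) ^+ 2).
  by rewrite ler_wpM2l// sqr_ge0.
have e : b ^+ 2 * ((`|y| / b) ^+ 2 - 1 + k * (`|y| / b - 1) ^+ 2) =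
   (k - 1) * b ^+ 2 - 2 * k * b * `|y| + (k + 1) * `|y| ^+ 2 by field.
have n1 : 2 * k * b * - `|y| <= 2 * k * b * y.
  rewrite ler_wpM2l//; first by apply: mulr_ge0; lra.
  by rewrite lerNl ler_normr lexx orbT.
have n2 : `|y| ^+ 2 = y ^+ 2 by rewrite real_normK ?num_real.
rewrite e n2 in hb; rewrite n2; lra.
Qed.

(** Cauchy-Schwarz, read off from the sum of squared deviations to the mean
s / k. *)
Lemma sqr_sum_le (R : realFieldType) (I : finType) (P : pred I) (x : I -> R)
    (k : R) : 0 < k -> \sum_(i | P i) 1 = k ->
  (\sum_(i | P i) x i) ^+ 2 <= k * \sum_(i | P i) x i ^+ 2.
Proof.
move=> k0 kE; set s := \sum_(i | P i) x i.
have : 0 <= \sum_(i | P i) (x i - s / k) ^+ 2 by apply: sumr_ge0 => i _; exact: sqr_ge0.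
have -> : \sum_(i | P i) (x i - s / k) ^+ 2 =
    \sum_(i | P i) (x i ^+ 2 + - (2 * s / k) * x i + (s / k) ^+ 2 * 1).
  by apply: eq_bigr => i _; ring.
rewrite !big_split /= -!mulr_sumr kE -/s => h.
have : 0 <= k * (\sum_(i | P i) x i ^+ 2 + - (2 * s / k) * s + (s / k) ^+ 2 * k).
  by rewrite mulr_ge0// ltW.
have -> : k * (\sum_(i | P i) x i ^+ 2 + - (2 * s / k) * s + (s / k) ^+ 2 * k)
  = k * (\sum_(i | P i) x i ^+ 2) - s ^+ 2 by field; lra.
by rewrite subr_ge0.
Qed.

(** Eliminating c leaves a quadratic equation in b with discriminant
proportional to n + 1 - (n + 2) a^2; b is its smaller root, positive because the
product of the roots has the sign of 2 a^2 - 1. *)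
Lemma two_value_solution (R : realType) (n a : R) : 0 < n -> 0 < a ->
  1 / 2 < a ^+ 2 -> (n + 2) * a ^+ 2 <= n + 1 ->
  exists b c : R, [/\ 0 < b, b <= c, a = c + n * b &
                    c ^+ 2 + n * b ^+ 2 = 1 - a ^+ 2].
Proof.
move=> n0 a0 a2 an.
pose D := n * (n + 1 - (n + 2) * a ^+ 2).
have D0 : 0 <= D by rewrite mulr_ge0//; lra.
pose q := Num.sqrt D.
have q0 : 0 <= q by rewrite sqrtr_ge0.
have qq : q ^+ 2 = D by rewrite sqr_sqrtr.
have nn : 0 < n * (n + 1) by rewrite mulr_gt0//; lra.
exists ((n * a - q) / (n * (n + 1))), ((a + q) / (n + 1)); split.
- rewrite divr_gt0// subr_gt0 -(@ltr_pXn2r _ 2) ?nnegrE//; last first.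
    by rewrite mulr_ge0// ltW.
  rewrite qq /D -subr_gt0.
  have -> : (n * a) ^+ 2 - n * (n + 1 - (n + 2) * a ^+ 2) =
    n * (n + 1) * (2 * a ^+ 2 - 1) by ring.
  by rewrite mulr_gt0//; lra.
- rewrite ler_pdivrMr//.
  have -> : (a + q) / (n + 1) * (n * (n + 1)) = n * a + n * q by field; lra.
  have : 0 <= n * q by rewrite mulr_ge0// ltW.
  lra.
- by field; lra.
have -> : ((a + q) / (n + 1)) ^+ 2 + n * ((n * a - q) / (n * (n + 1))) ^+ 2
   = (n * a ^+ 2 + q ^+ 2) / (n * (n + 1)) by field; lra.
by rewrite qq /D; field; lra.
Qed.

Lemma two_value_profile (R : realType) (n a b c : R) : 0 < n -> 0 < b ->
  0 < c -> a = c + n * b -> c ^+ 2 + n * b ^+ 2 = 1 - a ^+ 2 ->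
  sqr_ln_sqr a + sqr_ln_sqr c + n * sqr_ln_sqr b = profile n (b / c).
Proof.
move=> n0 b0 c0 aE cE.
set r := b / c.
have cn : c != 0 by lra.
have r0 : 0 < r by rewrite divr_gt0.
have nr : 0 < n * r by rewrite mulr_gt0.
have bE : b = c * r by rewrite /r; field.
clearbody r.
have aE' : a = c * (1 + n * r) by rewrite aE bE; ring.
have S1 : c ^+ 2 * profile_mass n r = 1.
  rewrite /profile_mass; rewrite aE' bE in cE; lra.
have [u1 S2 _] := profile_mass_ge n0 r0.
have lnS : ln (profile_mass n r) = - (2 * ln c).
  have := congr1 (@ln R) S1; rewrite lnM ?posrE ?exprn_gt0//; last by lra.
  by rewrite ln1 lnXn// -mulr_natr; lra.
have Sinv : (profile_mass n r)^-1 = c ^+ 2.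
  by apply: (@mulIf _ (profile_mass n r)); [lra|rewrite S1 mulVf//; lra].
have a0 : 0 < a by rewrite aE' mulr_gt0//; lra.
rewrite /profile lnS Sinv !sqr_ln_sqrE// aE' bE !lnM ?posrE//; last by lra.
rewrite /profile_mass in S1.
set L := ln c; set U := ln (1 + _); set V := ln r.
have : 2 * L * (c ^+ 2 * ((1 + n * r) ^+ 2 + 1 + n * r ^+ 2)) = 2 * L * 1 by rewrite S1.
lra.
Qed.

(** The other coordinates are replaced by (- c, - b, ..., - b), which has the
same sum and the same sum of squares; then r = b / c. *)
Lemma dominant_coordinate (R : realType) (n : nat) (x : 'I_n.+2 -> R)
    (i0 : 'I_n.+2) : (0 < n)%N -> \sum_i x i = 0 -> \sum_i x i ^+ 2 = 1 ->
  0 < x i0 -> 1 / 2 < x i0 ^+ 2 ->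
  exists2 r : R, 0 < r <= 1 & \sum_i sqr_ln_sqr (x i) <= profile n%:R r.
Proof.
move=> n_gt0 sx sx2 a0 a2; set a := x i0 in a0 a2.
have n0 : 0 < n%:R :> R by rewrite ltr0n.
have rest1 : \sum_(i | i != i0) x i = - a.
  by move: sx; rewrite (bigD1 i0)//= -/a; lra.
have rest2 : \sum_(i | i != i0) x i ^+ 2 = 1 - a ^+ 2.
  by move: sx2; rewrite (bigD1 i0)//= -/a; lra.
have rest0 : \sum_(i < n.+2 | i != i0) 1 = n%:R + 1 :> R.
  have : \sum_(i < n.+2) 1 = n%:R + 2 :> R.
    by rewrite sumr_const card_ord -natrD addn2.
  by rewrite (bigD1 i0)//=; lra.
have an : (n%:R + 2) * a ^+ 2 <= n%:R + 1.
  have := @sqr_sum_le _ _ (fun i => i != i0) x (n%:R + 1).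
  rewrite rest1 rest2 sqrrN => /(_ _ rest0) h.
  have : a ^+ 2 <= (n%:R + 1) * (1 - a ^+ 2) by apply: h; lra.
  lra.
have [b [c [b0 bc aE cE]]] := two_value_solution n0 a0 a2 an.
have c0 : 0 < c by lra.
exists (b / c); first by rewrite divr_gt0// ler_pdivrMr// mul1r.
have range j : j != i0 -> - c <= x j <= c.
  move=> ji0; set y := x j.
  have s0 : \sum_(i < n.+2 | (i != i0) && (i != j)) 1 = n%:R :> R.
    by move: rest0; rewrite (bigD1 j)//=; lra.
  have s1 : \sum_(i < n.+2 | (i != i0) && (i != j)) x i = - a - y.
    by move: rest1; rewrite (bigD1 j)//= -/y; lra.
  have s2 : \sum_(i < n.+2 | (i != i0) && (i != j)) x i ^+ 2 = 1 - a ^+ 2 - y ^+ 2.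
    by move: rest2; rewrite (bigD1 j)//= -/y; lra.
  have := sqr_sum_le x n0 s0; rewrite s1 s2 -cE aE => h.
  (* Cauchy-Schwarz for the n remaining coordinates: a quadratic inequality in y
     whose smaller root is - c and whose larger root is at most c. *)
  have {}h : (y + c) * ((n%:R + 1) * y + (c + 2 * n%:R * b - n%:R * c)) <= 0.
    lra.
  have nbc : 0 <= n%:R * (c - b) by rewrite mulr_ge0//; lra.
  have nb0 : 0 < n%:R * b by rewrite mulr_gt0//.
  apply/andP; split; rewrite leNgt; apply/negP => yc; move: h; apply/negP; rewrite -ltNge.
    rewrite nmulr_rgt0; last by lra.
    have : (n%:R + 1) * y < (n%:R + 1) * - c by rewrite ltr_pM2l//; lra.
    lra.
  apply: mulr_gt0; first by lra.
  have : (n%:R + 1) * c < (n%:R + 1) * y by rewrite ltr_pM2l//; lra.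
  lra.
rewrite -(two_value_profile n0 b0 c0 aE cE).
have [p [q [m [bP cP yP]]]] := sqr_ln_sqr_cert b0 bc.
rewrite (bigD1 i0)//= -addrA lerD2l.
have : \sum_(i | i != i0) sqr_ln_sqr (x i) <=
       \sum_(i | i != i0) (p * 1 + q * x i + m * x i ^+ 2).
  by apply: ler_sum => i ii0; rewrite mulr1; apply/yP/range.
rewrite !big_split /= -!mulr_sumr rest0 rest1 rest2 -cE bP cP => /le_trans; apply.
by rewrite aE; lra.
Qed.

Lemma sum_sqr_ln_sqr_le (R : realType) (n : nat) (x : 'I_n.+2 -> R) :
  (0 < n)%N -> \sum_i x i = 0 -> \sum_i x i ^+ 2 = 1 ->
  \sum_i sqr_ln_sqr (x i) <= - ln 2 \/
  \sum_i sqr_ln_sqr (x i) <= profile n%:R 1.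
Proof.
move=> n_gt0 sx sx2.
have n0 : 0 < n%:R :> R by rewrite ltr0n.
have [[i0 hi]|none] := pselect (exists i, 1 / 2 < x i ^+ 2).
  suff [r /andP[r0 r1] le_r] : exists2 r : R, 0 < r <= 1 &
      \sum_i sqr_ln_sqr (x i) <= profile n%:R r.
    by case: (profile_le_ends n0 r0 r1) => h; [left|right]; apply: le_trans h.
  have [xi0|xi0|xi0] := ltgtP (x i0) 0.
  - have -> : \sum_i sqr_ln_sqr (x i) = \sum_i sqr_ln_sqr (- x i).
      by apply: eq_bigr => i _; rewrite sqr_ln_sqrN.
    apply: (@dominant_coordinate _ _ (fun i => - x i) i0) => //.
    + by rewrite sumrN sx oppr0.
    + by rewrite -sx2; apply: eq_bigr => i _; rewrite sqrrN.
    + by rewrite oppr_gt0.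
    + by rewrite sqrrN.
  - exact: (@dominant_coordinate _ _ x i0).
  - by move: hi; rewrite xi0 expr0n /=; lra.
left.
have -> : - ln 2 = \sum_i x i ^+ 2 * - ln 2 by rewrite -mulr_suml sx2 mul1r.
apply: ler_sum => i _.
have [->|xi0] := eqVneq (x i) 0.
  by rewrite /sqr_ln_sqr expr0n /= !mul0r.
rewrite ler_wpM2l ?sqr_ge0// -lnV ?posrE// ler_ln ?posrE ?invr_gt0//; last first.
  by rewrite exprn_even_gt0.
by rewrite leNgt; apply/negP => h; apply: none; exists i; rewrite div1r.
Qed.


(** * Comparison of the two ends and the main theorem *)

Lemma profile1 (R : realType) (n : R) : 0 < n ->
  profile n 1 = n / (n + 2) * ln (n + 1) - ln (n + 2).
Proof.
move=> n0; have mE : profile_mass n 1 = (n + 1) * (n + 2).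
  by rewrite /profile_mass; ring.
rewrite /profile mE lnM ?posrE; try lra.
rewrite ln1 mulr1 (addrC 1 n); field; lra.
Qed.

Lemma ler_ln_nat (R : realType) (a b : nat) : (0 < a)%N -> (a <= b)%N ->
  ln a%:R <= ln b%:R :> R.
Proof.
move=> a0 ab; rewrite ler_ln ?ler_nat// posrE ltr0n//.
exact: leq_trans ab.
Qed.

(** The 3 bounds (1 + 1 / (n + 1))^(n + 1); the inequality is nearly tight at
n = 5, where it reads 126 <= 128. *)
Lemma leq_three_mul_exp2 (n : nat) : (5 <= n)%N ->
  (3 * (n.+2 * n.+1) <= 2 ^ n.+2)%N.
Proof.
elim: n => // n IH; rewrite leq_eqVlt => /predU1P[<-//|n5].
rewrite expnS; apply: leq_trans (leq_mul (leqnn 2) (IH n5)).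
nia.
Qed.

(** Equivalent to (d - 1)^(d - 2) <= (d / 2)^d for d = n + 2, checked for each of
the four values. *)
Lemma profile1_le (R : realType) (n : nat) : (0 < n <= 4)%N ->
  profile n%:R 1 <= - ln 2 :> R.
Proof.
move=> /andP[n_gt0 n4]; have n0 : 0 < n%:R :> R by rewrite ltr0n.
have : (n.+1 ^ n * 2 ^ n.+2 <= n.+2 ^ n.+2)%N.
  by move: n_gt0 n4; case: n {n0} => [|[|[|[|[|]]]]] // _ _; vm_compute.
move/(ler_ln_nat R); rewrite muln_gt0 !expn_gt0 => /(_ isT).
rewrite natrM lnM ?posrE ?ltr0n ?expn_gt0// !natrX !lnXn// ?ltr0n//.
rewrite -!(mulr_natr (ln _)) profile1// -[n.+2]addn2 -[n.+1]addn1 !natrD => h.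
rewrite -subr_ge0.
have -> : - ln 2 - (n%:R / (n%:R + 2) * ln (n%:R + 1) - ln (n%:R + 2)) =
  (ln (n%:R + 2) * (n%:R + 2) - (ln (n%:R + 1) * n%:R + ln 2 * (n%:R + 2)))
    / (n%:R + 2) :> R by field; lra.
by rewrite divr_ge0//; lra.
Qed.

(** With d = n + 2, splitting d ln d - (d - 2) ln (d - 1) as
(d - 1) (ln d - ln (d - 1)) + ln d + ln (d - 1), the first term is at most
1 <= ln 3, and 3 d (d - 1) <= 2^d. *)
Lemma profile1_ge (R : realType) (n : nat) : (5 <= n)%N ->
  - ln 2 <= profile n%:R 1 :> R.
Proof.
move=> n5; have n0 : 0 < n%:R :> R by rewrite ltr0n (leq_trans _ n5).
have := @ler_ln_nat R (3 * (n.+2 * n.+1)) _ isT (leq_three_mul_exp2 n5).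
rewrite natrX !natrM lnXn// !lnM ?posrE ?mulr_gt0 ?ltr0n//.
rewrite -(mulr_natr (ln _)) profile1// -[n.+2]addn2 -[n.+1]addn1 !natrD => h.
have step : (ln (n%:R + 2) - ln (n%:R + 1)) * (n%:R + 1) <= 1 :> R.
  rewrite -ler_pdivlMr; last by lra.
  rewrite -ln_div ?posrE; try lra.
  have -> : (n%:R + 2) / (n%:R + 1) = 1 + 1 / (n%:R + 1) :> R by field; lra.
  by apply/le_ln1Dx/(lt_trans (ltrN10 R))/divr_gt0; lra.
have l3 := ln3_ge1 R.
rewrite -subr_ge0.
have -> : n%:R / (n%:R + 2) * ln (n%:R + 1) - ln (n%:R + 2) - - ln 2 =
  (ln (n%:R + 1) * n%:R + ln 2 * (n%:R + 2) - ln (n%:R + 2) * (n%:R + 2))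
    / (n%:R + 2) :> R by field; lra.
by rewrite divr_ge0//; lra.
Qed.

Lemma sup_is_max (R : realType) (S : set R) (m : R) : is_max S m -> sup S = m.
Proof.
move=> [Sm ub]; apply/eqP; rewrite eq_le; apply/andP; split.
  by apply: ge_sup => //; exists m.
by apply: ub_le_sup => //; exists m.
Qed.

Lemma deficitE (R : realType) (d : nat) (x : 'I_d -> R) :
  ln d%:R - shannon (sq_distr x) = ln d%:R + \sum_i sqr_ln_sqr (x i).
Proof.
rewrite /shannon opprK; congr (_ + _); apply: eq_bigr => i _.
by rewrite /sq_distr /sqr_ln_sqr real_normK ?num_real.
Qed.

Lemma norm2_eq1 (R : realType) (d : nat) (x : 'I_d -> R) :
  norm2 x = 1 <-> \sum_i x i ^+ 2 = 1.
Proof.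
rewrite /norm2; split=> [h|->]; last by rewrite sqrtr1.
rewrite -[LHS]sqr_sqrtr; last by apply: sumr_ge0 => i _; exact: sqr_ge0.
by rewrite h expr1n.
Qed.

(** Attained at (1, - 1, 0, ..., 0) / sqrt 2. *)
Lemma deficits_ln_half (R : realType) (n : nat) :
  deficits R n.+2 (ln n.+2%:R - ln 2).
Proof.
pose c : R := Num.sqrt (1 / 2).
have cc : c ^+ 2 = 1 / 2 by rewrite sqr_sqrtr//; lra.
pose x (i : 'I_n.+2) : R := if i == 0 :> nat then c else if i == 1%N :> nat then - c else 0.
exists x; first split.
- by rewrite /zero_sum /= !big_ord_recl big1//= /x /=; ring.
- apply/norm2_eq1; rewrite !big_ord_recl big1//= /x /=; last by move=> i _; rewrite expr0n.
  by rewrite sqrrN cc; lra.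
rewrite deficitE; congr (_ + _).
rewrite !big_ord_recl big1 /= ?/x /=; last by move=> i _; rewrite /sqr_ln_sqr expr0n mul0r.
rewrite sqr_ln_sqrN /sqr_ln_sqr cc div1r lnV ?posrE//; lra.
Qed.

(** Attained at the normalization of (n + 1, - 1, ..., - 1), the point b = c of
the one-parameter family. *)
Lemma deficits_spike (R : realType) (n : nat) : (0 < n)%N ->
  deficits R n.+2 (ln n.+2%:R + profile n%:R 1).
Proof.
move=> n_gt0; have n0 : 0 < n%:R :> R by rewrite ltr0n.
pose c : R := Num.sqrt (((n%:R + 1) * (n%:R + 2))^-1).
have pos : 0 < (n%:R + 1) * (n%:R + 2) :> R by rewrite mulr_gt0//; lra.
have cc : c ^+ 2 = ((n%:R + 1) * (n%:R + 2))^-1.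
  by rewrite sqr_sqrtr// invr_ge0 ltW.
have c0 : 0 < c by rewrite sqrtr_gt0 invr_gt0.
pose a := (n%:R + 1) * c.
have aE : a = c + n%:R * c by rewrite /a; ring.
have cE : c ^+ 2 + n%:R * c ^+ 2 = 1 - a ^+ 2.
  have : (n%:R + 1) * (n%:R + 2) * c ^+ 2 = 1 by rewrite cc mulfV//; lra.
  by rewrite /a; lra.
pose x (i : 'I_n.+2) : R := if i == 0 :> nat then a else - c.
have xS (f : R -> R) : \sum_i f (x i) = f a + (n%:R + 1) * f (- c).
  rewrite -[n%:R + 1](natrD _ n 1) addn1 mulr_natl.
  by rewrite big_ord_recl /x /= sumr_const card_ord.
exists x; first split.
- by rewrite /zero_sum /= (xS id) aE; ring.
- by apply/norm2_eq1; rewrite (xS (fun z => z ^+ 2)) sqrrN; lra.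
rewrite deficitE xS; congr (_ + _).
have := two_value_profile n0 c0 c0 aE cE; rewrite divff ?lt0r_neq0// => <-.
by rewrite sqr_ln_sqrN; ring.
Qed.

(** Mean-zero functions are eigenfunctions of the generator, with eigenvalue
- d / (d - 1). *)
Lemma zero_sum_dirichlet (R : realType) (d : nat) (f : 'I_d -> R) :
  (1 < d)%N -> zero_sum f ->
  dirichlet f f = (d%:R - 1)^-1 * \sum_i f i ^+ 2.
Proof.
move=> d1 f0.
have dm : (d%:R - 1 : R) != 0 by rewrite subr_eq0 -[1]/(1%:R) eqr_nat gtn_eqF.
have d0 : (d%:R : R) != 0 by rewrite pnatr_eq0 -lt0n (ltn_trans _ d1).
rewrite /dirichlet /unif_mean.
have -> : \sum_i srw_gen f i * f i = - (d%:R / (d%:R - 1)) * \sum_i f i ^+ 2.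
  rewrite mulr_sumr; apply: eq_bigr => i _; rewrite /srw_gen.
  have -> : \sum_(j < d | j != i) f j = - f i.
    by move: f0; rewrite /zero_sum /= (bigD1 i)//=; lra.
  by field.
by field; rewrite dm.
Qed.

(** Both sides are homogeneous of degree 2 in f, so the bound on the deficit of
f / |f|_2 is enough. *)
Lemma entropy_sqr_le (R : realType) (d : nat) (m : R) (f : 'I_d -> R) :
  (0 < d)%N -> ubound (deficits R d) m -> zero_sum f ->
  entropy (fun i => f i ^+ 2) <= d%:R^-1 * m * \sum_i f i ^+ 2.
Proof.
move=> d_gt0 ub f0.
have d0 : 0 < d%:R :> R by rewrite ltr0n.
have dn : (d%:R : R) != 0 by lra.
rewrite /entropy /unif_mean; set Q := \sum_i f i ^+ 2.
have Q0 : 0 <= Q by apply: sumr_ge0 => i _; exact: sqr_ge0.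
have [Q_eq0|Q_neq0] := eqVneq Q 0.
  have fi i : f i ^+ 2 = 0.
    by apply: (psumr_eq0P (P := xpredT) (F := fun i => f i ^+ 2)) => // j _; exact: sqr_ge0.
  rewrite Q_eq0 !mulr0 mul0r subr0 big1 ?mulr0// => i _.
  by rewrite fi mul0r.
have Q_gt0 : 0 < Q by rewrite lt0r Q_neq0.
pose c := Num.sqrt Q.
have cc : c ^+ 2 = Q by rewrite sqr_sqrtr.
have cn : c != 0 by rewrite -(sqrf_eq0 c) cc.
pose x i := f i / c.
have : deficits R d (ln d%:R + \sum_i sqr_ln_sqr (x i)).
  exists x; last exact: deficitE.
  split; first by rewrite /zero_sum /= /x -mulr_suml f0 mul0r.
  apply/norm2_eq1; rewrite -[RHS](divff Q_neq0) /Q mulr_suml; apply: eq_bigr => i _.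
  by rewrite /x expr_div_n cc.
move=> /ub.
have -> : \sum_i sqr_ln_sqr (x i) = Q^-1 * (\sum_i f i ^+ 2 * ln (f i ^+ 2)) - ln Q.
  transitivity (\sum_i (Q^-1 * (f i ^+ 2 * ln (f i ^+ 2)) - (Q^-1 * ln Q) * f i ^+ 2)).
    apply: eq_bigr => i _; rewrite /sqr_ln_sqr /x expr_div_n cc.
    have [->|fi0] := eqVneq (f i) 0; first by rewrite !expr0n /= !mul0r !mulr0 subr0.
    rewrite ln_div ?posrE//; last by rewrite exprn_even_gt0.
    by field.
  rewrite sumrB -!mulr_sumr -/Q; congr (_ - _).
  by rewrite mulrAC mulVf// mul1r.
set T := \sum_i _ => le_m.
have TQ : Q^-1 * T * Q = T by field.
have : (ln d%:R + (Q^-1 * T - ln Q)) * Q <= m * Q by rewrite ler_wpM2r.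
rewrite mulrDl mulrBl TQ => h.
rewrite lnM ?posrE ?invr_gt0// lnV ?posrE//.
have : 0 <= d%:R^-1 * (m * Q - (ln d%:R * Q + (T - ln Q * Q))).
  by apply: mulr_ge0; rewrite ?invr_ge0 ?subr_ge0// ltW.
lra.
Qed.

Theorem mainTheorem4 (R : realType) (d : nat) (hd : (3 <= d)%N) :
  [/\ is_max (deficits R d) (delta R d),
      delta R d = (if (d <= 6)%N then ln (d%:R / 2)
                   else (d%:R - 2) / d%:R * ln (d%:R - 1)) &
      forall f : 'I_d -> R, zero_sum f ->
        entropy (fun i => f i ^+ 2)
          <= (d%:R - 1) / d%:R * delta R d * dirichlet f f].
Proof.
set v := (if (d <= 6)%N then _ else _).
suff vmax : is_max (deficits R d) v.
  have dv : delta R d = v by exact: sup_is_max.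
  rewrite dv; split=> // f f0.
  rewrite zero_sum_dirichlet//; last exact: leq_trans hd.
  have d3 : 3 <= d%:R :> R by rewrite ler_nat.
  have d_gt0 : (0 < d)%N by exact: leq_trans hd.
  apply: (le_trans (entropy_sqr_le d_gt0 vmax.2 f0)).
  by rewrite le_eqVlt; apply/orP; left; apply/eqP; field; lra.
rewrite {}/v; case: d hd => [|[|n]] // n_gt0; rewrite !ltnS in n_gt0.
have n0 : 0 < n%:R :> R by rewrite ltr0n.
have dE : n.+2%:R = n%:R + 2 :> R by rewrite -addn2 natrD.
have ub t : - ln 2 <= t -> profile n%:R 1 <= t -> ubound (deficits R n.+2) (ln n.+2%:R + t).
  move=> t1 t2 _ [x [x0 /norm2_eq1 x1] <-]; rewrite deficitE lerD2l.
  by have [|] := sum_sqr_ln_sqr_le n_gt0 x0 x1 => /le_trans; apply.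
case: ifP => [|/negbT]; rewrite !ltnS => n4.
  have -> : ln (n.+2%:R / 2) = ln n.+2%:R - ln 2 :> R by rewrite ln_div ?posrE.
  split; first exact: deficits_ln_half.
  by apply: ub => //; apply: profile1_le; rewrite n_gt0.
rewrite -ltnNge in n4.
have -> : (n.+2%:R - 2) / n.+2%:R * ln (n.+2%:R - 1) = ln n.+2%:R + profile n%:R 1 :> R.
  have -> : n.+2%:R - 1 = n%:R + 1 :> R by rewrite dE; ring.
  by rewrite profile1// dE addrK [RHS]addrC subrK.
split; first exact: deficits_spike.
by apply: ub => //; apply: profile1_ge.
Qed.
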